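(* Let $X$ be a random variable with values in $\mathbb{R}^d$, with compact support and $\mathbb{E}[|X|]<\infty$. Let $N\ge1$ be fixed. Let $\Theta$ be the set of parameters of the approximation spaces $\hat{\mathcal{G}}_L,\hat{\mathcal{B}}_M$. Assume that for all compact $K\subset\mathbb{R}^d$ and fixed $L,M$, $$\forall\alpha\in\mathcal{G}_L,\quad\lim_{\Theta\to\infty}d_{L^\infty(K\times B)}(\alpha,\hat{\mathcal{G}}_L)=0,$$ and also $$\forall b\in\mathcal{B}_M,\quad\lim_{\Theta\to\infty}d_{L^\infty(K)}(b,\hat{\mathcal{B}}_M)=0.$$ Then for any $\varepsilon>0$ there exist constants $L,M$ large enough and constants $(\eta_i,\varepsilon_i)_{i=1,2}$ small enough such that, for $\Theta$ large enough, Algorithm 1 gives $$\big|\mathbb{E}[\hat V_0(X)-V_0(X)]\big|\le\varepsilon.$$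
   Context: Let $T>0$, $\tau=T/N$. $A\subset\mathbb{R}^{n_A}$, $B\subset\mathbb{R}^{n_B}$ ($n_A,n_B\ge1$) are non-empty compact sets; $f:\mathbb{R}^d\times A\times B\to\mathbb{R}^d$, $g,\varphi:\mathbb{R}^d\to\mathbb{R}$ are Lipschitz continuous; $F(x,a,b)=x+\tau f(x,a,b)$. Write $p\vee q=\max(p,q)$ and $[\alpha]=\sup_{y\ne x}|\alpha(y)-\alpha(x)|/|y-x|$ for the Lipschitz constant. $\mathrm{Meas}(X,Y)$ is the set of measurable functions from $X$ to $Y$; $\mathcal{G}=\mathrm{Meas}(\mathbb{R}^d\times B,A)$, $\mathcal{B}=\mathrm{Meas}(\mathbb{R}^d,B)$, $\mathcal{G}_L=\{\alpha\in\mathcal{G}:[\alpha]\le L\}$, $\mathcal{B}_M=\{b\in\mathcal{B}:[b]\le M\}$. For $a\in A^N,b\in B^N$: $X^{a,b}_{0,x}=x$, $X^{a,b}_{k+1,x}=F(X^{a,b}_{k,x},a_k,b_k)$, $J_0(x,a,b)=\big(\max_{0\le k\le N-1}g(X^{a,b}_{k,x})\big)\vee\varphi(X^{a,b}_{N,x})$. $V_0(x)=\inf_{\alpha\in S_N}\sup_{b\in B^N}J_0(x,\alpha[b],b)$, where $S_N$ is the set of measurable $\alpha:B^N\to A^N$ such that each component $\alpha_k$ depends only on $(b_0,\dots,b_k)$. For $\alpha\in\mathcal{G}^N$, $b\in\mathcal{B}^N$: $\tilde J_0(x,\alpha[b],b)=\big(\max_{0\le k\le N-1}g(\tilde x_k)\big)\vee\varphi(\tilde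 x_N)$ with $\tilde x_0=x$, $\tilde x_{k+1}=F(\tilde x_k,\alpha_k(\tilde x_k,b_k(\tilde x_k)),b_k(\tilde x_k))$. Algorithm 1 (global scheme): let $\hat{\mathcal{G}}\subset\mathcal{G}$, $\hat{\mathcal{B}}\subset\mathcal{B}$ be approximation spaces (depending on parameters $\Theta$) and $\eta_1,\eta_2>0$ margin errors. The algorithm outputs $(\hat\alpha,\hat b)\in\hat{\mathcal{G}}^N\times\hat{\mathcal{B}}^N$ such that $$\sup_{b\in\hat{\mathcal{B}}^N}\mathbb{E}[\tilde J_0(X,\hat\alpha[b],b)]\le\inf_{\alpha\in\hat{\mathcal{G}}^N}\sup_{b\in\hat{\mathcal{B}}^N}\mathbb{E}[\tilde J_0(X,\alpha[b],b)]+\eta_1,$$ $$\mathbb{E}[\tilde J_0(X,\hat\alpha[\hat b],\hat b)]\ge\sup_{b\in\hat{\mathcal{B}}^N}\mathbb{E}[\tilde J_0(X,\hat\alpha[b],b)]-\eta_2,$$ and sets $\hat V_0(x):=\tilde J_0(x,\hat\alpha[\hat b],\hat b)$. Here $\hat{\mathcal{G}}_L=\hat{\mathcal{G}}\cap\mathcal{G}_L$ and $\hat{\mathcal{B}}_M=\hat{\mathcal{B}}\cap\mathcal{B}_M$, and the output is taken in $(\hat{\mathcal{G}}_L)^N\times(\hat{\mathcal{B}}_M)^N$. The constants $\varepsilon_1,\varepsilon_2>0$ are the accuracies with which $L$ and $M$ are chosen: there exist $\alpha^*\in(\mathcal{G}_L)^N$ with $\mathbb{E}[V_0(X)]\ge\sup_{b\in\mathcal{B}^N}\mathbb{E}[\tilde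 J_0(X,\alpha^*[b],b)]-\varepsilon_1$ and $b^*\in(\mathcal{B}_M)^N$ with $\mathbb{E}[V_0(X)]\le\mathbb{E}[\tilde J_0(X,\hat\alpha[b^*],b^* )]+\varepsilon_2$. For a set $K$ and a family $\mathcal{H}$ of functions on it, $d_{L^\infty(K)}(h,\mathcal{H})=\inf_{h'\in\mathcal{H}}\|h-h'\|_{L^\infty(K)}$, with $\|\cdot\|_{L^\infty(K)}$ the supremum norm on $K$.
   Formalization: Added assumption: for all positive η_i, ε_i there are L, M attaining accuracies ε_1, ε_2 (α* exists; b* exists for every algorithm output once Θ is large). Without it the claim fails, e.g. A={0,1}, B a point, where Lipschitz feedbacks are constant. *)

(* Defs.v *)
From HB Require Import structures.
From mathcomp Require Import all_boot all_order all_algebra.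
From mathcomp Require Import all_classical all_reals all_analysis.

Set Implicit Arguments.
Unset Strict Implicit.
Unset Printing Implicit Defensive.

Import Order.TTheory GRing.Theory Num.Theory numFieldNormedType.Exports.

Local Open Scope classical_set_scope.
Local Open Scope ring_scope.

(* R^n is 'rV[R]_n.  The norm of the library on row vectors is the maximum norm
   (same topology); Lipschitz constants and L^oo norms below use the Euclidean
   norm, on products as well. *)
Definition enorm (R : realType) n (v : 'rV[R]_n) : R :=
  Num.sqrt (\sum_(i < n) v ord0 i ^+ 2).

Definition enorm2 (R : realType) n m (z : 'rV[R]_n * 'rV[R]_m) : R :=
  Num.sqrt (enorm z.1 ^+ 2 + enorm z.2 ^+ 2).

Definition enorm3 (R : realType) n m p
    (z : 'rV[R]_n * 'rV[R]_m * 'rV[R]_p) : R :=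
  Num.sqrt (enorm z.1.1 ^+ 2 + enorm z.1.2 ^+ 2 + enorm z.2 ^+ 2).

Section lipschitz_constant_and_sup_norm.
Context {R : realType} {T : Type} {X Y : zmodType}.
Local Open Scope ereal_scope.

(* [h] on the domain D; it is -oo when D has at most one point. *)
Definition lip_const (nX : X -> R) (nY : Y -> R) (D : set X) (h : X -> Y)
    : \bar R :=
  ereal_sup [set r | exists x y, [/\ D x, D y, y != x &
                     r = (nY (h y - h x)%R / nX (y - x)%R)%:E]].

(* 0 is added to the set so that the norm is 0 when K is empty. *)
Definition sup_norm (nY : Y -> R) (K : set T) (u : T -> Y) : \bar R :=
  ereal_sup (0 |` [set (nY (u z))%:E | z in K]).

Definition dist_Linf (nY : Y -> R) (K : set T) (h : T -> Y)
    (H : set (T -> Y)) : \bar R :=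
  ereal_inf [set sup_norm nY K (fun z => h z - h' z)%R | h' in H].

End lipschitz_constant_and_sup_norm.

Definition borel (R : realType) n := g_sigma_algebraType (@open 'rV[R]_n).

Definition rv_support (R : realType) n dd (Omega : measurableType dd)
    (P : probability Omega R) (X : Omega -> 'rV[R]_n) : set 'rV[R]_n :=
  [set x | forall U, open U -> U x -> (0 < P (X @^-1` U))%E].

Record game (R : realType) (d nA nB N : nat) := Game {
  horizon : R;
  ctrlA : set 'rV[R]_nA;
  ctrlB : set 'rV[R]_nB;
  drift : 'rV[R]_d -> 'rV[R]_nA -> 'rV[R]_nB -> 'rV[R]_d;
  running : 'rV[R]_d -> R;
  terminal : 'rV[R]_d -> R }.

Section discrete_game.
Context {R : realType} {d nA nB N : nat} (G : game R d nA nB N).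

Local Notation state := 'rV[R]_d.
Local Notation A := (ctrlA G).
Local Notation B := (ctrlB G).

(* Feedback controls are total functions of which only the values on R^d * B
   (resp. R^d) matter: measurability, range and Lipschitz constants refer to
   that domain only. *)
Local Notation feedbackA := (state * 'rV[R]_nB -> 'rV[R]_nA).
Local Notation feedbackB := (state -> 'rV[R]_nB).

Definition tau : R := horizon G / N%:R.

Definition F (x : state) (a : 'rV[R]_nA) (b : 'rV[R]_nB) : state :=
  x + tau *: drift G x a b.

(* Only the values at k <= N matter. *)
Fixpoint traj (step : 'I_N -> state -> state) (x : state) (k : nat) : state :=
  if k is k'.+1 then
    let y := traj step x k' in
    if insub k' is Some i then step i y else y
  else x.

Definition payoff (X : nat -> state) : R :=
  \big[Num.max/terminal G (X N)]_(k < N) running G (X k).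

Definition J0 (x : state) (a : N.-tuple 'rV[R]_nA) (b : N.-tuple 'rV[R]_nB)
    : R :=
  payoff (traj (fun k y => F y (tnth a k) (tnth b k)) x).

Definition Jt0 (x : state) (alpha : 'I_N -> feedbackA) (b : 'I_N -> feedbackB)
    : R :=
  payoff (traj (fun k y => F y (alpha k (y, b k y)) (b k y)) x).

Definition ctrlAN : set (N.-tuple 'rV[R]_nA) :=
  [set a | forall k, A (tnth a k)].

Definition ctrlBN : set (N.-tuple 'rV[R]_nB) :=
  [set b | forall k, B (tnth b k)].

Definition nonanticipative
    : set (N.-tuple 'rV[R]_nB -> N.-tuple 'rV[R]_nA) :=
  [set s | [/\ measurable_fun (ctrlBN : set (N.-tuple (borel R nB)))
                 (s : N.-tuple (borel R nB) -> N.-tuple (borel R nA)),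
               forall b, ctrlBN b -> ctrlAN (s b) &
               forall (k : 'I_N) b b', ctrlBN b -> ctrlBN b' ->
                 (forall j : 'I_N, (j <= k)%N -> tnth b j = tnth b' j) ->
                 tnth (s b) k = tnth (s b') k]].

Definition V0 (x : state) : \bar R :=
  ereal_inf [set ereal_sup [set (J0 x (s b) b)%:E | b in ctrlBN]
            | s in nonanticipative].

Definition measG : set feedbackA :=
  [set alpha | measurable_fun ([set: borel R d] `*` (B : set (borel R nB)))
                 (alpha : borel R d * borel R nB -> borel R nA) /\
               forall x b, B b -> A (alpha (x, b))].

Definition measB : set feedbackB :=
  [set b | measurable_fun [set: borel R d] (b : borel R d -> borel R nB) /\
           forall x, B (b x)].

Definition lipG (L : R) : set feedbackA :=
  [set alpha | measG alpha /\
     (lip_const (@enorm2 R d nB) (@enorm R nA) ([set: state] `*` B) alpha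
        <= L%:E)%E].

Definition lipB (M : R) : set feedbackB :=
  [set b | measB b /\
     (lip_const (@enorm R d) (@enorm R nB) [set: state] b <= M%:E)%E].

Section expected_values.
Context {dd : measure_display} {Omega : measurableType dd}.
Context (P : probability Omega R) (X : Omega -> state).
Local Open Scope ereal_scope.

Definition EJt (alpha : 'I_N -> feedbackA) (b : 'I_N -> feedbackB) : \bar R :=
  'E_P[fun w => Jt0 (X w) alpha b].

Definition EV0 : \bar R := \int[P]_w V0 (X w).

Definition supEJt (Bs : set feedbackB) (alpha : 'I_N -> feedbackA) : \bar R :=
  ereal_sup [set EJt alpha b | b in [set b | forall k, Bs (b k)]].

(* (ahat, bhat) is a possible output of the algorithm with approximation spaces
   Gs, Bs and margin errors eta1, eta2, the output being Lipschitz with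
   constants L, M. *)
Definition algorithm1 (Gs : set feedbackA) (Bs : set feedbackB)
    (L M eta1 eta2 : R) (ahat : 'I_N -> feedbackA) (bhat : 'I_N -> feedbackB)
    : Prop :=
  [/\ forall k, (Gs `&` lipG L) (ahat k),
      forall k, (Bs `&` lipB M) (bhat k),
      supEJt Bs ahat <=
        ereal_inf [set supEJt Bs alpha
                  | alpha in [set alpha | forall k, Gs (alpha k)]] + eta1%:E &
      EJt ahat bhat >= supEJt Bs ahat - eta2%:E].

Definition accuracy1 (L eps1 : R) : Prop :=
  exists2 alpha : 'I_N -> feedbackA, (forall k, lipG L (alpha k)) &
    EV0 >= supEJt measB alpha - eps1%:E.

Definition accuracy2 (ahat : 'I_N -> feedbackA) (M eps2 : R) : Prop :=
  exists2 b : 'I_N -> feedbackB, (forall k, lipB M (b k)) &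
    EV0 <= EJt ahat b + eps2%:E.

(* L and M are chosen with accuracies eps1 and eps2.  As M is fixed before the
   parameters Theta, it must serve every output of the algorithm for Theta
   large enough. *)
Definition accurate {Theta : Type} (Finf : set_system Theta)
    (Ghat : Theta -> set feedbackA) (Bhat : Theta -> set feedbackB)
    (L M eta1 eta2 eps1 eps2 : R) : Prop :=
  accuracy1 L eps1 /\
  \forall th \near Finf, forall ahat bhat,
    algorithm1 (Ghat th) (Bhat th) L M eta1 eta2 ahat bhat ->
    accuracy2 ahat M eps2.

End expected_values.
End discrete_game.

(* Main.v *)
Require Import Defs.
From HB Require Import structures.
From mathcomp Require Import all_boot all_order all_algebra.
From mathcomp Require Import all_classical all_reals all_analysis.
From mathcomp Require Import measurable_realfun lra.

Set Implicit Arguments.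
Unset Strict Implicit.
Unset Printing Implicit Defensive.

Import Order.TTheory GRing.Theory Num.Theory numFieldNormedType.Exports.

Local Open Scope classical_set_scope.
Local Open Scope ring_scope.

(* The support of X being bounded, all trajectories stay almost surely in a fixed
   compact set K, on which the density hypotheses are applied.

   Upper bound: pick alpha' in the approximation space close on K to the almost
   optimal alpha*.  The feedbacks b are only measurable, so the trajectories of
   (alpha', b) and (alpha*, b) cannot be compared.  Instead, restrict the
   maximizer to a finite net of B and let W be the resulting dynamic programming
   value against alpha*.  W is Lipschitz, it is attained by a measurable (argmax)
   feedback, and a one-step comparison along any trajectory of (alpha', b) bounds
   the payoff by W plus an error that is small with the mesh and the distance
   between alpha' and alpha*.

   Lower bound: the almost optimal b* depends on the output of the algorithm,
   hence on Theta, so the approximation of b* must be uniform over all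
   M-Lipschitz feedbacks; this holds as they form a totally bounded set on K. *)

(** * Comparison of Euclidean and maximum norms; Lipschitz constants *)

Section norms.
Context {R : realType}.
Implicit Types n m p : nat.

Lemma enorm_ge0 n (v : 'rV[R]_n) : 0 <= enorm v.
Proof. exact: sqrtr_ge0. Qed.

Lemma enorm0 n : enorm (0 : 'rV[R]_n) = 0.
Proof.
by rewrite /enorm big1 ?sqrtr0// => i _; rewrite mxE expr0n.
Qed.

Lemma norm_le_enorm n (v : 'rV[R]_n) : `|v| <= enorm v.
Proof.
rewrite [leLHS]/Num.Def.normr/= mx_normrE bigmax_le ?enorm_ge0// => -[i j] _ /=.
rewrite ord1 -sqrtr_sqr ler_wsqrtr// (bigD1 j)//= lerDl.
by apply: sumr_ge0 => k _; exact: sqr_ge0.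
Qed.

Lemma normv_entry_le n (v : 'rV[R]_n) i : `|v ord0 i| <= `|v|.
Proof.
rewrite [leRHS]/Num.Def.normr/= mx_normrE.
by apply: (le_bigmax _ (fun ij : 'I_1 * 'I_n => `|v ij.1 ij.2|) (ord0, i)).
Qed.

Lemma enorm_le_norm n (v : 'rV[R]_n) : enorm v <= n%:R * `|v|.
Proof.
have nv0 : 0 <= n%:R * `|v| by rewrite mulr_ge0.
rewrite -[leRHS]ger0_norm// -sqrtr_sqr ler_wsqrtr//.
have /le_trans : \sum_(i < n) v ord0 i ^+ 2 <= \sum_(i < n) `|v| ^+ 2.
  apply: ler_sum => i _.
  by rewrite -[v ord0 i ^+ 2]real_normK ?num_real// ler_sqr ?nnegrE ?normv_entry_le.
apply; rewrite sumr_const card_ord -[leLHS]mulr_natl exprMn.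
by rewrite ler_wpM2r ?sqr_ge0// -natrX ler_nat; case: n {v nv0} => // n; rewrite -mulnn leq_pmulr.
Qed.

Lemma enorm_gt0 n (v : 'rV[R]_n) : v != 0 -> 0 < enorm v.
Proof. by rewrite -normr_gt0 => /lt_le_trans; apply; exact: norm_le_enorm. Qed.

Lemma sqrt_sum3_le (a b c : R) : 0 <= a -> 0 <= b -> 0 <= c ->
  Num.sqrt (a ^+ 2 + b ^+ 2 + c ^+ 2) <= a + b + c.
Proof.
move=> a0 b0 c0; have abc : 0 <= a + b + c by rewrite !addr_ge0.
rewrite -[leRHS]ger0_norm// -sqrtr_sqr ler_wsqrtr//.
have := mulr_ge0 a0 b0; have := mulr_ge0 a0 c0; have := mulr_ge0 b0 c0.
nra.
Qed.

Lemma enorm3_le n m p (z : 'rV[R]_n * 'rV[R]_m * 'rV[R]_p) :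
  enorm3 z <= (n + m + p)%:R * (`|z.1.1| + `|z.1.2| + `|z.2|).
Proof.
apply: (le_trans (sqrt_sum3_le (enorm_ge0 _) (enorm_ge0 _) (enorm_ge0 _))).
have := enorm_le_norm z.1.1; have := enorm_le_norm z.1.2.
have := enorm_le_norm z.2; rewrite !natrD.
have := normr_ge0 z.1.1; have := normr_ge0 z.1.2; have := normr_ge0 z.2.
have := ler0n R n; have := ler0n R m; have := ler0n R p.
set a := `|z.1.1|; set b := `|z.1.2|; set c := `|z.2|.
move: (n%:R) (m%:R) (p%:R) => N M K K0 M0 N0 c0 b0 a0.
have := mulr_ge0 N0 b0; have := mulr_ge0 N0 c0; have := mulr_ge0 M0 a0.
have := mulr_ge0 M0 c0; have := mulr_ge0 K0 a0; have := mulr_ge0 K0 b0.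
lra.
Qed.

(** A pair is a triple with last entry in the zero-dimensional space, so the estimates for [enorm3]
    yield those for [enorm2]. *)
Lemma enorm2E n m (z : 'rV[R]_n * 'rV[R]_m) :
  enorm2 z = enorm3 (z, 0 : 'rV[R]_0).
Proof. by rewrite /enorm2 /enorm3 /= enorm0 expr0n addr0. Qed.

Lemma enorm3_gt0 n m p (z : 'rV[R]_n * 'rV[R]_m * 'rV[R]_p) :
  z != 0 -> 0 < enorm3 z.
Proof.
move: z => [[u v] w]; rewrite -!pair_eqE /= /pair_eq /= !negb_and => uvw.
rewrite sqrtr_gt0/=.
have u0 := sqr_ge0 (enorm u); have v0 := sqr_ge0 (enorm v).
have w0 := sqr_ge0 (enorm w).
have [uE|uN0] := eqVneq u 0; last first.
  by have := exprn_gt0 2 (enorm_gt0 uN0); lra.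
have [vE|vN0] := eqVneq v 0; last first.
  by have := exprn_gt0 2 (enorm_gt0 vN0); lra.
have [wE|wN0] := eqVneq w 0; last first.
  by have := exprn_gt0 2 (enorm_gt0 wN0); lra.
by move: uvw; rewrite uE vE wE !eqxx.
Qed.

Lemma enorm2_gt0 n m (z : 'rV[R]_n * 'rV[R]_m) : z != 0 -> 0 < enorm2 z.
Proof.
move=> z0; rewrite enorm2E enorm3_gt0//; apply: contra_neq z0.
by move=> /(congr1 fst).
Qed.

Lemma enorm2_le n m (z : 'rV[R]_n * 'rV[R]_m) :
  enorm2 z <= (n + m)%:R * (`|z.1| + `|z.2|).
Proof.
rewrite enorm2E; apply: le_trans (enorm3_le _) _ => /=.
by rewrite normr0 addr0 addn0.
Qed.

(** The supremum ranges over distinct points only; on the diagonal, as [nY 0 = 0], the claim reads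
    [0 <= L * nX 0], hence the sign conditions. *)
Lemma lip_const_le (X Y : zmodType) (nX : X -> R) (nY : Y -> R) (D : set X)
    (h : X -> Y) (L : R) x y :
  (forall z, z != 0 -> 0 < nX z) -> 0 <= nX 0 -> nY 0 = 0 ->
  (lip_const nX nY D h <= L%:E)%E -> 0 <= L -> D x -> D y ->
  nY (h x - h y) <= L * nX (x - y).
Proof.
move=> nX0 nX00 nY0 hL L0 Dx Dy; have [->|yx] := eqVneq x y.
  by rewrite !subrr nY0 mulr_ge0.
rewrite -ler_pdivrMr ?nX0 ?subr_eq0// -lee_fin (le_trans _ hL)//.
by apply: ereal_sup_ubound => /=; exists y, x.
Qed.

Lemma lip_const_bound (X Y : zmodType) (nX : X -> R) (nY : Y -> R)
    (D : set X) (h : X -> Y) :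
  (lip_const nX nY D h < +oo)%E ->
  exists2 L : R, 0 <= L & (lip_const nX nY D h <= L%:E)%E.
Proof.
case: (lip_const _ _ _ _) => [r| |] // _; last by exists 0 => //; rewrite leNye.
by exists (Num.max r 0); rewrite ?lee_fin le_max lexx ?orbT.
Qed.

Lemma lip_const_mono (X Y : zmodType) (nX : X -> R) (nY : Y -> R)
    (D : set X) (h : X -> Y) (L L' : R) : L <= L' ->
  (lip_const nX nY D h <= L%:E)%E -> (lip_const nX nY D h <= L'%:E)%E.
Proof. by move=> LL' /le_trans; apply; rewrite lee_fin. Qed.

End norms.

(** Discrete Gronwall inequality; as [1 <= q], the factor [q ^+ N] serves all [k <= N] at once. *)
Lemma linear_recurrence_le (R : realFieldType) (N : nat) (u : nat -> R) (q e : R) :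
  1 <= q -> 0 <= e -> 0 <= u 0%N ->
  (forall k, (k < N)%N -> u k.+1 <= q * u k + e) ->
  forall k, (k <= N)%N -> u k <= q ^+ N * (u 0%N + N%:R * e).
Proof.
move=> q1 e0 u0 uS k kN.
have -> // : u k <= q ^+ k * (u 0%N + k%:R * e) -> u k <= q ^+ N * (u 0%N + N%:R * e).
  move=> /le_trans; apply; apply: ler_pM.
  - by rewrite exprn_ge0// (le_trans ler01).
  - by rewrite addr_ge0// mulr_ge0.
  - exact: ler_weXn2l.
  - by rewrite lerD2l ler_wpM2r// ler_nat.
elim: k kN => [|k IH] kN; first by rewrite expr0 mul1r mul0r addr0.
apply: (le_trans (uS _ kN)).
have /le_trans : q * u k + e <= q * (q ^+ k * (u 0%N + k%:R * e)) + e.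
  by rewrite lerD2r ler_wpM2l ?IH// ?(ltnW kN)// (le_trans ler01).
apply; rewrite mulrA -exprS -[k.+1%:R]natr1 mulrDl mul1r addrA [leRHS]mulrDr lerD2l.
by rewrite ler_peMl// exprn_ege1.
Qed.

(** * Stability of trajectories and payoffs, and Lipschitz regularity of the value *)

Section trajectories.
Context {R : realType} {d nA nB N : nat} (G : game R d nA nB N).
Local Notation state := 'rV[R]_d.
Local Notation A := (ctrlA G).
Local Notation B := (ctrlB G).

Lemma trajS (step : 'I_N -> state -> state) x k (kN : (k < N)%N) :
  traj step x k.+1 = step (Ordinal kN) (traj step x k).
Proof. by rewrite /= insubT. Qed.

Lemma payoff_le (X : nat -> state) (e : R) :
  terminal G (X N) <= e -> (forall k, (k < N)%N -> running G (X k) <= e) ->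
  payoff G X <= e.
Proof. by move=> Xe Xk; apply: bigmax_le => // k _; exact: Xk. Qed.

Lemma terminal_le_payoff (X : nat -> state) : terminal G (X N) <= payoff G X.
Proof. exact: bigmax_ge_id. Qed.

Lemma running_le_payoff (X : nat -> state) k : (k < N)%N ->
  running G (X k) <= payoff G X.
Proof.
move=> kN; exact: (le_bigmax _ (fun i : 'I_N => running G (X i)) (Ordinal kN)).
Qed.

Context (C c kappa : R) (C0 : 0 <= C) (c1 : 1 <= c) (kappa0 : 0 <= kappa).
Context (F_lip : forall x x' a a' b b', A a -> A a' -> B b -> B b' ->
  `|F G x a b - F G x' a' b'| <= c * (`|x - x'| + `|a - a'| + `|b - b'|)).
Context (F_growth : forall x a b, A a -> B b ->
  `|F G x a b| <= c * `|x| + kappa).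
Context (running_lip : forall x x',
  `|running G x - running G x'| <= C * `|x - x'|).
Context (terminal_lip : forall x x',
  `|terminal G x - terminal G x'| <= C * `|x - x'|).

Let c0 : 0 <= c := le_trans ler01 c1.

Lemma payoff_perturb (X Y : nat -> state) (e : R) :
  (forall k, (k <= N)%N -> `|X k - Y k| <= e) ->
  payoff G X <= payoff G Y + C * e.
Proof.
move=> XY.
have lip (h : state -> R) k : (k <= N)%N ->
    (forall x x', `|h x - h x'| <= C * `|x - x'|) -> h (X k) <= h (Y k) + C * e.
  move=> kN hL; rewrite -lerBlDl; apply: le_trans (ler_norm _) _.
  by apply: le_trans (hL _ _) _; rewrite ler_wpM2l// XY.
apply: payoff_le => [|k kN].
  by apply: (le_trans (lip _ _ _ terminal_lip)) => //; rewrite lerD2r terminal_le_payoff.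
apply: (le_trans (lip _ _ (ltnW kN) running_lip)).
by rewrite lerD2r running_le_payoff.
Qed.

(** Covers open-loop and feedback trajectories alike, so that the growth bounds are proved once for
    both. *)
Definition controlled (X : nat -> state) := forall k, (k < N)%N ->
  exists a b, [/\ A a, B b & X k.+1 = F G (X k) a b].

Lemma controlled_bounded X k : controlled X -> (k <= N)%N ->
  `|X k| <= c ^+ N * (`|X 0%N| + N%:R * kappa).
Proof.
move=> cX; apply: (@linear_recurrence_le _ _ (fun k => `|X k|)) => // j jN.
by have [a [b [Aa Bb ->]]] := cX _ jN; exact: F_growth.
Qed.

Lemma controlled_payoff_bounded X : controlled X ->
  `|payoff G X| <= `|running G 0| + `|terminal G 0|
                   + C * (c ^+ N * (`|X 0%N| + N%:R * kappa)).
Proof.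
move=> cX; set r := c ^+ N * _.
have lip (h : state -> R) k : (k <= N)%N ->
    (forall x x', `|h x - h x'| <= C * `|x - x'|) ->
    `|h (X k)| <= `|h 0| + C * r.
  move=> kN hL; rewrite -lerBlDl; apply: le_trans (lerB_dist _ _) _.
  by apply: le_trans (hL _ _) _; rewrite subr0 ler_wpM2l// controlled_bounded.
have g0 := normr_ge0 (running G 0); have phi0 := normr_ge0 (terminal G 0).
have := lip _ _ (leqnn N) terminal_lip; rewrite ler_norml => /andP[h1 h2].
rewrite ler_norml; apply/andP; split.
  by apply: le_trans (terminal_le_payoff _); lra.
apply: payoff_le; first lra.
move=> k kN; have := lip _ _ (ltnW kN) running_lip; rewrite ler_norml => /andP[]; lra.
Qed.

Lemma feedback_controlled x (alpha : 'I_N -> _) (b : 'I_N -> _) :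
  (forall k, measG G (alpha k)) -> (forall k y, B (b k y)) ->
  controlled (traj (fun k y => F G y (alpha k (y, b k y)) (b k y)) x).
Proof.
move=> Galpha Bb k kN; rewrite (trajS _ _ kN).
set y := traj _ _ _; set i := Ordinal kN.
by exists (alpha i (y, b i y)), (b i y); split => //; apply (Galpha i).2.
Qed.

Lemma openloop_controlled x a b : ctrlAN G a -> ctrlBN G b ->
  controlled (traj (fun k y => F G y (tnth a k) (tnth b k)) x).
Proof.
move=> Aa Bb k kN; rewrite (trajS _ _ kN).
by exists (tnth a (Ordinal kN)), (tnth b (Ordinal kN)).
Qed.

(** The bound on [b] and [b'] combines Lipschitz dependence on the state with a uniform error:
    [delta = 0] gives continuity in the initial point, [delta > 0] the replacement of a feedback by
    an approximation. It is asked at states [y] of [K] only, which contains the first trajectory.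
    One step multiplies the distance of the trajectories by the displayed factor and adds
    [c * (La + 1) * delta]; Gronwall concludes. *)
Lemma Jt0_perturb (La Lb delta : R) (K : set state) x x'
    (alpha : 'I_N -> _) (b b' : 'I_N -> _) :
  0 <= La -> 0 <= Lb -> 0 <= delta ->
  (forall k, measG G (alpha k)) ->
  (forall k y, B (b k y)) -> (forall k y, B (b' k y)) ->
  (forall k y z u v, B u -> B v ->
     `|alpha k (y, u) - alpha k (z, v)| <= La * (`|y - z| + `|u - v|)) ->
  (forall k y z, K y -> `|b k y - b' k z| <= Lb * `|y - z| + delta) ->
  (forall k, (k < N)%N ->
     K (traj (fun k y => F G y (alpha k (y, b k y)) (b k y)) x k)) ->
  Jt0 G x alpha b <= Jt0 G x' alpha b' +
    C * ((c * (1 + La * (1 + Lb) + Lb)) ^+ N *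
         (`|x - x'| + N%:R * (c * (La + 1) * delta))).
Proof.
move=> La0 Lb0 delta0 Galpha Bb Bb' alphaL bb' KX.
apply: payoff_perturb.
set X := traj _ x; set Y := traj _ x'.
have q1 : 1 <= c * (1 + La * (1 + Lb) + Lb).
  rewrite -[leLHS]mulr1 ler_pM// -addrA lerDl addr_ge0// mulr_ge0// addr_ge0//.
apply: (@linear_recurrence_le _ _ (fun k => `|X k - Y k|)) => //.
  by rewrite mulr_ge0// mulr_ge0// addr_ge0.
move=> k kN; have {KX}KXk := KX _ kN; rewrite -/X in KXk.
rewrite /X /Y !(trajS _ _ kN) -/X -/Y; set i := Ordinal kN.
have := bb' i (X k) (Y k) KXk.
have := alphaL i (X k) (Y k) (b i (X k)) (b' i (Y k)) (Bb _ _) (Bb' _ _).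
have Aa z u : B u -> A (alpha i (z, u)) by move=> Bu; apply (Galpha i).2.
have := F_lip (X k) (Y k) (Aa (X k) _ (Bb i (X k))) (Aa (Y k) _ (Bb' i (Y k)))
  (Bb i (X k)) (Bb' i (Y k)).
move=> /le_trans + ha hb; apply.
rewrite -!mulrA -mulrDr ler_wpM2l//.
apply: (le_trans (lerD (lerD (lexx _) ha) hb)).
have : La * (`|X k - Y k| + `|b i (X k) - b' i (Y k)|) <=
       La * (`|X k - Y k| + (Lb * `|X k - Y k| + delta)).
  by rewrite ler_wpM2l// lerD2l.
lra.
Qed.

Lemma Jt0_lip (La Lb : R) x x' (alpha : 'I_N -> _) (b : 'I_N -> _) :
  0 <= La -> 0 <= Lb ->
  (forall k, measG G (alpha k)) -> (forall k y, B (b k y)) ->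
  (forall k y z u v, B u -> B v ->
     `|alpha k (y, u) - alpha k (z, v)| <= La * (`|y - z| + `|u - v|)) ->
  (forall k y z, `|b k y - b k z| <= Lb * `|y - z|) ->
  `|Jt0 G x alpha b - Jt0 G x' alpha b| <=
    C * (c * (1 + La * (1 + Lb) + Lb)) ^+ N * `|x - x'|.
Proof.
move=> La0 Lb0 alphaG Bb alphaL bL.
have le y z : Jt0 G y alpha b <= Jt0 G z alpha b +
    C * (c * (1 + La * (1 + Lb) + Lb)) ^+ N * `|y - z|.
  have := @Jt0_perturb La Lb 0 setT y z alpha b b La0 Lb0 (lexx _) alphaG Bb Bb alphaL.
  rewrite !mulr0 addr0 mulrA; apply => // k y' z' _.
  by rewrite addr0; exact: bL.
have := le x x'; have := le x' x; rewrite (distrC x' x) => h1 h2.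
by rewrite ler_norml; apply/andP; split; lra.
Qed.

(** Both trajectories use the same open-loop controls, so only the dependence of [F] on the state
    enters, with factor [c] per step. *)
Lemma J0_lip x x' a b : ctrlAN G a -> ctrlBN G b ->
  J0 G x a b <= J0 G x' a b + C * (c ^+ N * `|x - x'|).
Proof.
move=> Aa Bb; apply: payoff_perturb.
set X := traj _ x; set Y := traj _ x'.
move=> k kN; have -> : `|x - x'| = `|X 0%N - Y 0%N| + N%:R * 0 by rewrite mulr0 addr0.
apply: (@linear_recurrence_le _ _ (fun k => `|X k - Y k|)) kN => // {}k kN.
rewrite /X /Y !(trajS _ _ kN) -/X -/Y addr0.
set i := Ordinal kN.
apply: (le_trans (F_lip (X k) (Y k) (Aa i) (Aa i) (Bb i) (Bb i))).
by rewrite !subrr !normr0 !addr0.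
Qed.

(** A constant strategy and a constant control give finiteness; the bound on [J0], uniform in
    strategies and controls, passes through the supremum and the infimum. The real-valued [v] makes
    the value measurable and integrable along [X]. *)
Lemma V0_lip : A !=set0 -> B !=set0 ->
  exists2 v : state -> R, (forall x, V0 G x = (v x)%:E) &
    forall x x', `|v x - v x'| <= C * c ^+ N * `|x - x'|.
Proof.
move=> [a Aa] [b Bb].
pose a' := [tuple of nseq N a]; pose b' := [tuple of nseq N b].
have Aa' : ctrlAN G a' by move=> k; rewrite tnth_nseq.
have Bb' : ctrlBN G b' by move=> k; rewrite tnth_nseq.
pose S x (s : N.-tuple 'rV[R]_nB -> N.-tuple 'rV[R]_nA) :=
  ereal_sup [set (J0 G x (s b) b)%:E | b in ctrlBN G].
have fin x : V0 G x \is a fin_num.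
  pose m := `|running G 0| + `|terminal G 0| + C * (c ^+ N * (`|x| + N%:R * kappa)).
  rewrite fin_numElt; apply/andP; split.
    apply: (@lt_le_trans _ _ (- m)%:E); first exact: ltNyr.
    apply: le_ereal_inf_tmp => _ [s [_ sA _] <-].
    apply: (@le_trans _ _ (J0 G x (s b') b')%:E); last first.
      by apply: ereal_sup_ubound; exists b'.
    have := controlled_payoff_bounded (openloop_controlled x (sA _ Bb') Bb').
    by rewrite lee_fin ler_norml => /andP[].
  apply: (@le_lt_trans _ _ m%:E); last exact: ltry.
  apply: (@le_trans _ _ (S x (fun=> a'))).
    by apply: ereal_inf_lbound; exists (fun=> a').
  rewrite /S; apply: ge_ereal_sup => _ [u Bu <-].
  have := controlled_payoff_bounded (openloop_controlled x Aa' Bu).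
  by rewrite lee_fin ler_norml => /andP[].
have V0L x x' : (V0 G x <= V0 G x' + (C * c ^+ N * `|x - x'|)%:E)%E.
  rewrite -leeBlDr//; apply: le_ereal_inf_tmp => _ [s [s1 sA s3] <-].
  rewrite leeBlDr//; apply: (@le_trans _ _ (S x s)).
    by apply: ereal_inf_lbound; exists s.
  rewrite /S; apply: ge_ereal_sup => _ [u Bu <-].
  apply: (@le_trans _ _ (J0 G x' (s u) u + (C * c ^+ N * `|x - x'|))%:E).
    by rewrite lee_fin -mulrA; apply: J0_lip => //; exact: sA.
  by rewrite EFinD leeD2r//; apply: ereal_sup_ubound; exists u.
exists (fun x => fine (V0 G x)) => [x|x x']; first by rewrite fineK.
have := V0L x x'; have := V0L x' x; rewrite -(fineK (fin x)) -(fineK (fin x')).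
rewrite -!EFinD !lee_fin /= distrC => h1 h2.
by rewrite ler_norml; apply/andP; split; lra.
Qed.

End trajectories.

(** * Measurable selection of a maximizer over a finite set *)

Lemma lipschitz_borel (R : realType) n (h : 'rV[R]_n -> R) (k : R) :
  (forall x x', `|h x - h x'| <= k * `|x - x'|) ->
  measurable_fun [set: borel R n] (h : borel R n -> R).
Proof.
move=> hk; have /continuousP ch : continuous h.
  move=> x; have FFx := @nbhs_pfilter _ (x : 'rV[R]_n).
  apply/(@cvgrPdist_lt _ _ _ (nbhs (x : 'rV[R]_n)) _) => e e0; near=> y.
  have k1 : 0 < `|k| + 1 by rewrite ltr_wpDl.
  apply: (le_lt_trans (hk x y)).
  apply: (@le_lt_trans _ _ ((`|k| + 1) * `|x - y|)).
    by rewrite ler_wpM2r// (le_trans (ler_norm k))// lerDl.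
  rewrite mulrC -ltr_pdivlMr//; near: y.
  apply/nbhs_ballP; exists (e / (`|k| + 1)); first by rewrite /= divr_gt0.
  by move=> y; rewrite -ball_normE.
apply: (measurability _ (RGenOpens.measurableE R)).
move=> _ [_ [a [b ->] <-]]; rewrite setTI; apply: sub_sigma_algebra.
exact/ch/interval_open.
Unshelve. all: end_near. Qed.

Lemma dist_max_le (R : realDomainType) (a a' b b' e : R) :
  `|a - a'| <= e -> `|b - b'| <= e -> `|Num.max a b - Num.max a' b'| <= e.
Proof. by rewrite !ler_norml => /andP[? ?] /andP[? ?]; case: (leP a b); case: (leP a' b') => ? ?; apply/andP; split; lra. Qed.

(** Built by successive comparisons, ties going to the head, so that measurability follows by
    induction on the list; [y0] makes the set of candidates nonempty. *)
Fixpoint argmax_seq (R : realType) (U V : Type) (h : U -> V -> R) (y0 : U)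
    (s : seq U) (x : V) : U :=
  if s is y :: s' then
    let z := argmax_seq h y0 s' x in if h z x <= h y x then y else z
  else y0.

Section argmax_seq.
Context {R : realType} {n m : nat}.
Implicit Types (U : eqType) (h : 'rV[R]_m -> 'rV[R]_n -> R).

Lemma argmax_seq_mem U V (h : U -> V -> R) y0 s x :
  argmax_seq h y0 s x \in y0 :: s.
Proof.
elim: s => [|y s IH] /=; first by rewrite mem_seq1.
case: ifP => _; first by rewrite !inE eqxx orbT.
by move: IH; rewrite !inE => /orP[] ->; rewrite ?orbT.
Qed.

Lemma argmax_seq_max U V (h : U -> V -> R) y0 s x y : y \in y0 :: s ->
  h y x <= h (argmax_seq h y0 s x) x.
Proof.
elim: s y => [|z s IH] y /=; first by rewrite mem_seq1 => /eqP ->.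
rewrite !inE orbCA => /orP[/eqP ->|ys]; first by
  case: ifP => // /negbT; rewrite -ltNge => /ltW.
by have := IH y; rewrite inE => /(_ ys); case: ifP => // h1 /le_trans; apply.
Qed.

(** The maximizer may jump, but the value it realizes is a maximum of finitely many [k]-Lipschitz
    functions. *)
Lemma argmax_seq_lip h y0 s (k : R) :
  (forall y x x', y \in y0 :: s -> `|h y x - h y x'| <= k * `|x - x'|) ->
  forall x x', `|h (argmax_seq h y0 s x) x - h (argmax_seq h y0 s x') x'|
    <= k * `|x - x'|.
Proof.
move=> hk.
have le x x' : h (argmax_seq h y0 s x) x <=
    h (argmax_seq h y0 s x') x' + k * `|x - x'|.
  have := argmax_seq_max h x' (argmax_seq_mem h y0 s x).
  have := hk _ x x' (argmax_seq_mem h y0 s x); rewrite ler_norml => /andP[].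
  by lra.
move=> x x'; have := le x x'; have := le x' x; rewrite (distrC x' x) => h1 h2.
by rewrite ler_norml; apply/andP; split; lra.
Qed.

(** Each comparison is between two Lipschitz, hence Borel, functions: the maximum over the tail and
    the value at the head. *)
Lemma measurable_argmax_seq h y0 s (k : R) :
  (forall y x x', y \in y0 :: s -> `|h y x - h y x'| <= k * `|x - x'|) ->
  measurable_fun [set: borel R n]
    (argmax_seq h y0 s : borel R n -> borel R m).
Proof.
elim: s => [|y s IH] hk; first exact: measurable_cst.
have hks z x x' : z \in y0 :: s -> `|h z x - h z x'| <= k * `|x - x'|.
  by move=> zs; apply: hk; move: zs; rewrite !inE => /orP[->|->]; rewrite ?orbT.
apply: measurable_fun_ifT; [|exact: measurable_cst|exact: IH].
apply: measurable_fun_ler; apply: (@lipschitz_borel _ _ _ k).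
  exact: argmax_seq_lip.
by move=> x x'; apply: hk; rewrite !inE eqxx orbT.
Qed.

End argmax_seq.

(** * Dynamic programming against a fixed [alpha] with finitely many moves *)

Section dynamic_programming.
Context {R : realType} {d nA nB N : nat} (G : game R d nA nB N).
Local Notation state := 'rV[R]_d.
Local Notation A := (ctrlA G).
Local Notation B := (ctrlB G).
Context (C c La : R) (C0 : 0 <= C) (c1 : 1 <= c) (La0 : 0 <= La).
Context (F_lip : forall x x' a a' b b', A a -> A a' -> B b -> B b' ->
  `|F G x a b - F G x' a' b'| <= c * (`|x - x'| + `|a - a'| + `|b - b'|)).
Context (running_lip : forall x x',
  `|running G x - running G x'| <= C * `|x - x'|).
Context (terminal_lip : forall x x',
  `|terminal G x - terminal G x'| <= C * `|x - x'|).
Context (alpha : 'I_N -> state * 'rV[R]_nB -> 'rV[R]_nA).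
Context (alphaG : forall k, measG G (alpha k)).
Context (alpha_lip : forall k y z u v, B u -> B v ->
  `|alpha k (y, u) - alpha k (z, v)| <= La * (`|y - z| + `|u - v|)).
Context (y0 : 'rV[R]_nB) (s : seq 'rV[R]_nB).
Context (sB : forall y, y \in y0 :: s -> B y).

Let c0 : 0 <= c := le_trans ler01 c1.

(* The junk value [x] for k >= N is never used. *)
Definition step_ctrl (k : nat) (y : 'rV[R]_nB) (x : state) : state :=
  if insub k is Some i then F G x (alpha i (x, y)) y else x.

(* The value of the game against [alpha] when [j] steps remain and the
   maximizer is restricted to the finite set [y0 :: s]. *)
Fixpoint net_value (j : nat) (x : state) : R :=
  if j is j'.+1 then
    let h y x := net_value j' (step_ctrl (N - j) y x) in
    Num.max (running G x) (h (argmax_seq h y0 s x) x)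
  else terminal G x.

(** The greedy choice at time [k]; once it is played, [N - k.+1] steps remain. *)
Definition net_feedback (k : 'I_N) : state -> 'rV[R]_nB :=
  argmax_seq (fun y x => net_value (N - k.+1) (step_ctrl k y x)) y0 s.

(** Lipschitz constant in the state of one step under [alpha], the maximizer's move being fixed. *)
Let q := c * (1 + La).

Let q1 : 1 <= q.
Proof. by rewrite -[leLHS]mulr1 ler_pM// lerDl. Qed.

Lemma step_ctrl_lip k y x x' : y \in y0 :: s ->
  `|step_ctrl k y x - step_ctrl k y x'| <= q * `|x - x'|.
Proof.
move=> /sB By; rewrite /step_ctrl; case: insub => [i|]; last by rewrite ler_peMl.
have A1 := (alphaG i).2 x y By; have A2 := (alphaG i).2 x' y By.
apply: (le_trans (F_lip x x' A1 A2 By By)).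
rewrite -mulrA ler_wpM2l// subrr normr0 addr0 mulrDl mul1r lerD2l.
by have := alpha_lip i x x' By By; rewrite subrr normr0 addr0.
Qed.

(** Each backward step composes with a [q]-Lipschitz map and takes maxima; as [1 <= q], the constant
    [C] of the running cost is absorbed. *)
Lemma net_value_lip j x x' : (j <= N)%N ->
  `|net_value j x - net_value j x'| <= C * q ^+ j * `|x - x'|.
Proof.
elim: j x x' => [|j IH] x x' jN; first by rewrite expr0 mulr1; exact: terminal_lip.
have hL y z z' : y \in y0 :: s ->
    `|net_value j (step_ctrl (N - j.+1) y z) -
      net_value j (step_ctrl (N - j.+1) y z')| <= C * q ^+ j.+1 * `|z - z'|.
  move=> ys; apply: le_trans (IH _ _ (ltnW jN)) _.
  rewrite exprSr [C * _ in leRHS]mulrA -[leRHS]mulrA.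
  rewrite ler_wpM2l ?step_ctrl_lip//.
  by rewrite mulr_ge0// exprn_ge0// (le_trans ler01).
have Cq : C <= C * q ^+ j.+1 by rewrite ler_peMr// exprn_ege1.
apply: dist_max_le.
  by apply: (le_trans (running_lip x x')); rewrite ler_wpM2r.
exact: argmax_seq_lip hL _ _.
Qed.

Lemma net_feedback_meas k : measB G (net_feedback k).
Proof.
split; last by move=> x; apply: sB; exact: argmax_seq_mem.
apply: (@measurable_argmax_seq _ _ _ _ _ _ (C * q ^+ (N - k.+1) * q)).
move=> y x x' ys; apply: le_trans (net_value_lip _ _ (leq_subr _ _)) _.
rewrite -[leRHS]mulrA ler_wpM2l ?step_ctrl_lip//.
by rewrite mulr_ge0// exprn_ge0// (le_trans ler01).
Qed.

(** The Bellman equation in terms of the elapsed time [k]; the recursion on remaining steps recovers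
    it as [N - (N - k) = k]. *)
Lemma net_value_step k x : (k < N)%N ->
  net_value (N - k) x = Num.max (running G x)
    (net_value (N - k.+1) (step_ctrl k (argmax_seq
       (fun y x => net_value (N - k.+1) (step_ctrl k y x)) y0 s x) x)).
Proof.
by move=> kN; rewrite -{1}(subnSK kN) /= subnSK// subKn// ltnW.
Qed.

(** Backward induction along the trajectory of the greedy feedback, whose states are exactly those
    met in the recursion of [net_value]. *)
Lemma net_value_le_Jt0 x : net_value N x <= Jt0 G x alpha net_feedback.
Proof.
rewrite /Jt0; set X := traj _ x.
suff H : forall j k, (k + j)%N = N -> net_value j (X k) <= payoff G X.
  exact: (H N 0%N).
elim=> [|j IH] k kjN.
  by rewrite -[k]addn0 kjN; exact: terminal_le_payoff.
have kN : (k < N)%N by rewrite -kjN addnS ltnS leq_addr.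
have jE : j.+1 = (N - k)%N by rewrite -kjN addKn.
rewrite jE net_value_step// ge_max running_le_payoff//=.
have -> : (N - k.+1)%N = j by rewrite subnS -jE.
have -> : argmax_seq (fun y x0 => net_value j (step_ctrl k y x0)) y0 s (X k) =
    net_feedback (Ordinal kN) (X k) by rewrite /net_feedback/= subnS -jE.
have -> : step_ctrl k (net_feedback (Ordinal kN) (X k)) (X k) = X k.+1.
  by rewrite [X in _ = X](trajS _ _ kN) /step_ctrl insubT.
by rewrite IH// -kjN addSnnS.
Qed.

(** No move of the net beats the greedy one, so [net_value (N - k) (X k)] grows by at most
    [C * q ^+ N * e] per step, and it dominates the running and terminal costs. The sequence [X] is
    arbitrary, which allows discontinuous feedbacks. *)
Lemma payoff_le_net_value (X : nat -> state) (e : R) : 0 <= e ->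
  (forall k, (k < N)%N -> exists2 y, y \in y0 :: s &
    `|X k.+1 - step_ctrl k y (X k)| <= e) ->
  payoff G X <= net_value N (X 0%N) + N%:R * (C * q ^+ N * e).
Proof.
move=> e0 Xe; set E := C * q ^+ N * e.
have qk k : 0 <= q ^+ k by rewrite exprn_ge0// (le_trans ler01).
have E0 : 0 <= E by rewrite !mulr_ge0.
have H k : (k <= N)%N -> net_value (N - k) (X k) <= net_value N (X 0%N) + k%:R * E.
  elim: k => [|k IH] kN; first by rewrite mul0r addr0 subn0.
  have := IH (ltnW kN); rewrite net_value_step// ge_max => /andP[_].
  have [y ys Xy] := Xe k kN.
  have := argmax_seq_max
    (fun y x => net_value (N - k.+1) (step_ctrl k y x)) (X k) ys.
  have := net_value_lip (X k.+1) (step_ctrl k y (X k)) (leq_subr k.+1 N).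
  have : C * q ^+ (N - k.+1) * `|X k.+1 - step_ctrl k y (X k)| <= E.
    rewrite /E ler_pM ?mulr_ge0// ler_wpM2l//.
    by rewrite ler_weXn2l// leq_subr.
  rewrite ler_norml -[k.+1%:R]natr1 mulrDl mul1r => h1 /andP[h2 h3] /=.
  by lra.
have HN k : (k <= N)%N -> net_value (N - k) (X k) <= net_value N (X 0%N) + N%:R * E.
  by move=> kN; apply: (le_trans (H k kN)); rewrite lerD2l ler_wpM2r// ler_nat.
apply: payoff_le => [|k kN]; first by have := HN N (leqnn N); rewrite subnn.
by have := HN k (ltnW kN); rewrite net_value_step// ge_max => /andP[].
Qed.

(** In the factor [La + 2], one [delta] is the gap between [alpha'] and [alpha], [La * delta] the
    effect on [alpha] of rounding the move to the net, and the other [delta] the effect of that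
    rounding in [F] itself. *)
Lemma Jt0_le_net_value x (alpha' : 'I_N -> _) (b : 'I_N -> _) (K : set state)
    (delta : R) : 0 <= delta ->
  (forall k, measG G (alpha' k)) -> (forall k z, B (b k z)) ->
  (forall u, B u -> exists2 y, y \in y0 :: s & `|u - y| <= delta) ->
  (forall k z u, K z -> B u ->
     `|alpha k (z, u) - alpha' k (z, u)| <= delta) ->
  (forall k, (k < N)%N ->
     K (traj (fun k y => F G y (alpha' k (y, b k y)) (b k y)) x k)) ->
  Jt0 G x alpha' b <=
    net_value N x + N%:R * (C * q ^+ N * (c * (La + 2) * delta)).
Proof.
move=> delta0 alpha'G Bb net aa' KX; rewrite /Jt0; set X := traj _ x.
apply: payoff_le_net_value => [|k kN].
  by rewrite !mulr_ge0// addr_ge0.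
have [y ys uy] := net _ (Bb (Ordinal kN) (X k)); exists y => //.
rewrite {1}/X (trajS _ _ kN) -/X /step_ctrl insubT.
set i := Ordinal kN; set u := b i (X k).
have Bu : B u by exact: Bb.
have By := sB ys.
have h1 := aa' i _ _ (KX _ kN) Bu; rewrite -/X in h1.
have h2 := alpha_lip i (X k) (X k) Bu By.
apply: le_trans (F_lip _ _ ((alpha'G i).2 _ _ Bu) ((alphaG i).2 _ _ By) Bu By) _.
rewrite -[leRHS]mulrA ler_wpM2l// subrr normr0 add0r.
have := ler_distD (alpha i (X k, u)) (alpha' i (X k, u)) (alpha i (X k, y)).
rewrite subrr normr0 add0r in h2; rewrite [in X in _ <= X -> _]distrC.
have : La * `|u - y| <= La * delta by rewrite ler_wpM2l.
by rewrite -/u in uy; lra.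
Qed.

End dynamic_programming.

(** * Comparison of integrals *)

Section integral_comparison.
Context d (T : measurableType d) (R : realType) (mu : {measure set T -> \bar R}).
Local Open Scope ereal_scope.

(* No measurability is needed: the integral is a supremum over simple functions. *)
Lemma le_integral_pointwise (f g : T -> \bar R) : (forall x, f x <= g x) ->
  \int[mu]_x f x <= \int[mu]_x g x.
Proof.
move=> fg; rewrite /integral !patch_setT; apply: leeB; apply: ereal_sup_le.
  move=> _ [h hf <-]; exists h => // x; apply: (le_trans (hf x)).
  by rewrite !funeposE ge_max !le_max fg lexx orbT.
move=> _ [h hf <-]; exists h => // x; apply: (le_trans (hf x)).
by rewrite !funenegE ge_max !le_max leeN2 fg lexx orbT.
Qed.

(** Setting [g] to +oo outside [E] changes it on a null set only, and turns the inequality on [E]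
    into one at every point. *)
Lemma le_integral_ae (f g : T -> \bar R) (E : set T) : measurable E ->
  mu (~` E) = 0 -> measurable_fun [set: T] g ->
  (forall x, E x -> f x <= g x) ->
  \int[mu]_x f x <= \int[mu]_x g x.
Proof.
move=> mE muE mg fg; pose g' x := if x \in E then g x else +oo.
have mg' : measurable_fun [set: T] g'.
  apply: measurable_fun_ifT => //; apply: (measurable_fun_bool true).
  rewrite setTI (_ : _ @^-1` _ = E)//.
  by apply/seteqP; split => x /=; [exact: set_mem|exact: mem_set].
have -> : \int[mu]_x g x = \int[mu]_x g' x.
  apply: ae_eq_integral => //; exists (~` E); split => //.
    exact: measurableC.
  by move=> x /= xE Ex; apply: xE => _; rewrite /g' mem_set.
apply: le_integral_pointwise => x; rewrite /g'.
have [xE|xE] := boolP (x \in E); last by rewrite leey.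
exact/fg/set_mem.
Qed.

End integral_comparison.

(** * Integrability of functions of the random vector, and boundedness of its law *)

Section random_vector.
Context {R : realType} {n : nat} {dd : measure_display}
  {Omega : measurableType dd} (P : probability Omega R) (X : Omega -> 'rV[R]_n).
Context (X_meas : measurable_fun [set: Omega] (X : Omega -> borel R n)).

Lemma measurable_preimage_open (U : set 'rV[R]_n) : open U ->
  measurable (X @^-1` U).
Proof.
move=> oU; rewrite -[_ @^-1` _]setTI; apply: X_meas => //.
exact: sub_sigma_algebra.
Qed.

Lemma lipschitz_comp_measurable (h : 'rV[R]_n -> R) (k : R) :
  (forall x x', `|h x - h x'| <= k * `|x - x'|) ->
  measurable_fun [set: Omega] (h \o X).
Proof.
by move=> hk; apply: (@measurableT_comp _ _ _ _ _ _ (h : borel R n -> R)) => //;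
  exact: lipschitz_borel hk.
Qed.

Lemma measurable_norm_le (r : R) : measurable [set w | `|X w| <= r].
Proof.
have := @lipschitz_comp_measurable (fun x => `|x|) 1 _.
rewrite (_ : [set w | _] = setT `&` (Num.norm \o X) @^-1` `]-oo, r]%classic).
  apply => // x x'; rewrite mul1r; exact: ler_dist_dist.
by apply/seteqP; split => w /=; rewrite in_itv/= => // -[].
Qed.

Lemma lipschitz_integrable (h : 'rV[R]_n -> R) (k : R) :
  ('E_P[fun w => enorm (X w)] < +oo)%E ->
  (forall x x', `|h x - h x'| <= k * `|x - x'|) ->
  P.-integrable [set: Omega] (fun w => (h (X w))%:E).
Proof.
rewrite unlock => EX hk.
have mX : measurable_fun [set: Omega] (fun w => `|X w|).
  apply: (@lipschitz_comp_measurable (fun x => `|x|) 1) => x x'.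
  by rewrite mul1r; exact: ler_dist_dist.
have iX : P.-integrable [set: Omega] (fun w => `|X w|%:E).
  apply/integrableP; split; first exact/measurable_EFinP.
  apply: le_lt_trans EX; apply: le_integral_pointwise => w /=.
  by rewrite lee_fin normr_id norm_le_enorm.
apply: (@le_integrable _ _ _ _ _ _ _
  (fun w => (`|h 0|%:E + `|k|%:E * `|X w|%:E)%E)) => //.
- apply/measurable_EFinP; exact: lipschitz_comp_measurable hk.
- move=> w _; rewrite -EFinM -EFinD lee_fin.
  rewrite [leRHS]ger0_norm ?addr_ge0// -lerBlDl.
  apply: (le_trans (lerB_dist _ _)); apply: (le_trans (hk _ _)).
  by rewrite subr0 ler_wpM2r// ler_norm.
- apply: integrableD => //; last exact: integrableZl.
  exact: (@finite_measure_integrable_cst _ _ _ P _ (`|h 0|)).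
Qed.

(** Every point off the support has a null open neighbourhood; the complement of the ball is covered
    by countably many compact shells, each covered by finitely many such neighbourhoods. *)
Lemma rv_support_bounded : compact (rv_support P X) ->
  exists2 r : R, 0 <= r & P (~` [set w | `|X w| <= r]) = 0%E.
Proof.
move=> /compact_bounded[M [Mreal SM]].
(* The support obeys every bound above [M]; the margin of 1 keeps even the points of norm [r] off
   it. *)
pose r := Num.max 0 (M + 1).
exists r; first by rewrite le_max lexx.
(* At points of the support the empty set serves, so that the choice of [U] is total. *)
have nullnbhd x : exists U : set 'rV[R]_n, [/\ open U, P (X @^-1` U) = 0%E &
    (~ rv_support P X x) -> U x].
  have [Sx|] := pselect (rv_support P X x).
    by exists set0; split; [exact: open0|rewrite preimage_set0 measure0|].
  move=> /[dup] Sx /existsNP[U /not_implyP[oU /not_implyP[Ux PU]]].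
  exists U; split => //; apply/eqP; rewrite eq_le measure_ge0 andbT leNgt.
  exact/negP.
have [U HU] := choice nullnbhd.
have nullX x : P.-negligible (X @^-1` U x).
  have [oU PU _] := HU x; apply/negligibleP => //.
  exact: measurable_preimage_open.
pose D k := [set x : 'rV[R]_n | r <= `|x| <= k%:R].
have cD k : compact (D k).
  apply: bounded_closed_compact.
    exists k%:R; split; first exact: num_real.
    by move=> y ky x /andP[_ xk]; exact: le_trans (ltW ky).
  rewrite (_ : D k = (fun x => `|x|) @^-1` `[r, k%:R]%classic).
    apply: closed_comp => [x _|]; [exact: norm_continuous|exact: interval_closed].
  by apply/seteqP; split => x /=; rewrite in_itv.
have nullD k : P.-negligible (X @^-1` D k).
  have := cD k; rewrite compact_cover => /(_ _ (D k) U)[].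
  - by move=> x _; have [] := HU x.
  - move=> x Dx; exists x => //; have [_ _] := HU x; apply => Sx.
    have := SM (M + 2^-1); rewrite ltrDl invr_gt0 ltr0n => /(_ isT x Sx).
    move: Dx; rewrite /D /= /r ge_max => /andP[/andP[_ h1] _] h2.
    by have := le_trans h1 h2; rewrite lerD2l; lra.
  move=> D' _ DD'.
  (* The finite union is written as a countable one: past the end of the list [nth] returns 0, and
     [U 0] has a null preimage as well. *)
  have nullU : P.-negligible (\bigcup_i X @^-1` U (nth 0 (finmap.enum_fset D') i)).
    by apply: negligible_bigcup => i; exact: nullX.
  apply: negligibleS nullU => w /DD'[x xD' Ux]; exists (index x (finmap.enum_fset D')) => //.
  by rewrite /= nth_index.
apply/negligibleP; first exact/measurableC/measurable_norm_le.
have := negligible_bigcup nullD; apply: negligibleS => w /= /negP; rewrite -ltNge => rX.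
exists (Num.truncn `|X w|).+1 => //; rewrite /D /preimage /= (ltW rX)/=.
by rewrite ltW// truncnS_gt.
Qed.

End random_vector.

(** * Finite nets and uniform approximation of equi-Lipschitz families *)

Lemma near_forall_seq (T : Type) (F : set_system T) (FF : Filter F)
    (I : eqType) (s : seq I) (Q : I -> T -> Prop) :
  (forall y, y \in s -> \forall t \near F, Q y t) ->
  \forall t \near F, forall y, y \in s -> Q y t.
Proof.
elim: s => [|y s IH] H; first exact: nearW.
have H1 := H y (mem_head _ _).
have H2 : \forall t \near F, forall z, z \in s -> Q z t.
  by apply: IH => z zs; apply: H; rewrite inE zs orbT.
by apply: filterS2 H1 H2 => t Qy Qs z; rewrite inE => /orP[/eqP ->|/Qs].
Qed.

Lemma compact_net (R : realType) n (K : set 'rV[R]_n) (delta : R) :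
  compact K -> 0 < delta ->
  exists2 s : seq 'rV[R]_n, (forall y, y \in s -> K y) &
    forall x, K x -> exists2 y, y \in s & `|x - y| <= delta.
Proof.
move=> cK d0; have := cK; rewrite compact_cover => /(_ _ K (fun x => ball x delta))[].
- by move=> x _; exact: ball_open.
- by move=> x Kx; exists x => //; exact: ballxx.
move=> D DK KD; exists (finmap.enum_fset D) => [y yD|x Kx].
  by apply: set_mem; exact: DK.
have [y yD xy] := KD _ Kx; exists y => //.
by move: xy; rewrite -ball_normE /= distrC => /ltW.
Qed.

Lemma dist_Linf_near (R : realType) (Theta : Type) (Finf : set_system Theta)
    (FF : Filter Finf) (T : Type) m (K : set T) (h : T -> 'rV[R]_m)
    (H : Theta -> set (T -> 'rV[R]_m)) (delta : R) :
  dist_Linf (@enorm R m) K h (H th) @[th --> Finf] --> 0%E -> 0 < delta ->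
  \forall th \near Finf,
    exists2 h', H th h' & forall z, K z -> `|h z - h' z| <= delta.
Proof.
move=> hH d0.
have : \forall th \near Finf, (dist_Linf (@enorm R m) K h (H th) < delta%:E)%E.
  apply: (hH [set u | (u < delta%:E)%E]); apply: open_ereal_lt'.
  by rewrite lte_fin.
apply: filterS => th /ereal_inf_lt[_ [h' Hh' <-] hh']; exists h' => // z Kz.
apply: le_trans (norm_le_enorm _) _; rewrite -lee_fin.
apply: le_trans (ltW hh'); apply: ereal_sup_ubound; right.
by exists z.
Qed.

(* An equi-Lipschitz family with values in a compact set is totally bounded for
   uniform convergence on compact sets, so approximability is uniform on it. *)
Lemma uniform_approximation (R : realType) (Theta : Type)
    (Finf : set_system Theta) (FF : Filter Finf) n m (K : set 'rV[R]_n)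
    (B : set 'rV[R]_m) (Lip : set ('rV[R]_n -> 'rV[R]_m))
    (H : Theta -> set ('rV[R]_n -> 'rV[R]_m)) (k delta : R) :
  compact K -> compact B ->
  (forall f x, Lip f -> B (f x)) ->
  (forall f x x', Lip f -> `|f x - f x'| <= k * `|x - x'|) ->
  (forall f, Lip f ->
     dist_Linf (@enorm R m) K f (H th) @[th --> Finf] --> 0%E) ->
  0 < delta ->
  \forall th \near Finf, forall f, Lip f ->
    exists2 h, H th h & forall x, K x -> `|f x - h x| <= delta.
Proof.
move=> cK cB LipB Lipk LipH d0.
(* Two fifths for moving between [x] and a net point in [f] and in [g], two for the gap of [f] and
   [g] at that point, one for approximating [g]. *)
have d5 : 0 < delta / 5 by rewrite divr_gt0.
have k1 : 0 < `|k| + 1 by rewrite ltr_wpDl.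
have [sB sBB netB] := compact_net cB d5.
have [sK _ netK] := compact_net cK (divr_gt0 d5 k1).
have Lipk' f x x' : Lip f -> `|x - x'| <= delta / 5 / (`|k| + 1) ->
    `|f x - f x'| <= delta / 5.
  move=> Lf; rewrite ler_pdivlMr// mulrC; apply: le_trans.
  apply: (le_trans (Lipk _ _ _ Lf)); rewrite ler_wpM2r//.
  by rewrite (le_trans (ler_norm k))// lerDl.
(* Induction over the net of [K]: at each point the family is split by the net points of [B] near
   its value, until one [g] represents each nonempty piece. Approximability is thus invoked for
   finitely many functions, whence a common condition on [th]. *)
have key : forall S : set ('rV[R]_n -> 'rV[R]_m), S `<=` Lip ->
    \forall th \near Finf, forall f, S f -> exists g h, [/\ S g, H th h,
      forall x, K x -> `|g x - h x| <= delta / 5 &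
      forall x, x \in sK -> `|f x - g x| <= delta / 5 + delta / 5].
  elim: sK {netK} => [|x s IH] S SL.
    have [[g Sg]|S0] := pselect (S !=set0); last first.
      by apply: nearW => th f Sf; exfalso; apply: S0; exists f.
    have := dist_Linf_near FF (LipH _ (SL _ Sg)) d5; apply: filterS.
    by move=> th [h Hh gh] f Sf; exists g, h; split.
  have : forall y, y \in sB -> \forall th \near Finf, forall f,
      (S `&` [set f | `|f x - y| <= delta / 5]) f -> exists g h,
      [/\ (S `&` [set f | `|f x - y| <= delta / 5]) g, H th h,
      forall x, K x -> `|g x - h x| <= delta / 5 &
      forall x, x \in s -> `|f x - g x| <= delta / 5 + delta / 5].
    by move=> y _; apply: IH => f [/SL].
  move/(near_forall_seq FF); apply: filterS => th Hth f Sf.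
  have [y ysB fxy] := netB _ (LipB f x (SL _ Sf)).
  have [g [h [[Sg gxy] Hh gh fg]]] := Hth y ysB f (conj Sf fxy).
  exists g, h; split => // z; rewrite inE => /orP[/eqP ->|]; last exact: fg.
  by apply: le_trans (ler_distD y _ _) _; rewrite lerD// distrC.
apply: filterS (key Lip (fun _ => id)) => th Hth f Lf.
have [g [h [Lg Hh gh fg]]] := Hth f Lf; exists h => // x Kx.
have [y ys xy] := netK x Kx.
have yx : `|y - x| <= delta / 5 / (`|k| + 1) by rewrite distrC.
have := Lipk' _ _ _ Lf xy; have := fg _ ys; have := Lipk' _ _ _ Lg yx.
have := gh _ Kx.
have := ler_distD (f y) (f x) (h x); have := ler_distD (g y) (f y) (h x).
have := ler_distD (g x) (g y) (h x).
lra.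
Qed.

(** * Shifted expectations, compact balls, and the constants of the game *)

Lemma expectation_addr (R : realType) dd (Omega : measurableType dd)
    (P : probability Omega R) (u : Omega -> R) (e : R) :
  P.-integrable [set: Omega] (fun w => (u w)%:E) ->
  (\int[P]_w (u w + e)%:E = \int[P]_w (u w)%:E + e%:E)%E.
Proof.
move=> iu; under eq_integral do rewrite EFinD.
rewrite integralD//; last exact: (@finite_measure_integrable_cst _ _ _ P _ e).
by rewrite integral_cst//= probability_setT mule1.
Qed.

Lemma closed_ball_compact (R : realType) n (r : R) :
  compact [set x : 'rV[R]_n | `|x| <= r].
Proof.
apply: bounded_closed_compact.
  exists r; split; first exact: num_real.
  by move=> y ry x xr; exact: le_trans (ltW ry).
rewrite (_ : [set _ | _] = (fun x => `|x|) @^-1` `]-oo, r]%classic).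
  apply: closed_comp => [x _|]; [exact: norm_continuous|exact: interval_closed].
by apply/seteqP; split => x /=; rewrite in_itv.
Qed.

Section game_bounds.
Context {R : realType} {d nA nB N : nat} (G : game R d nA nB N).
Local Notation A := (ctrlA G).
Local Notation B := (ctrlB G).

Lemma lipG_norm (L : R) alpha y z u v : 0 <= L -> lipG G L alpha ->
  B u -> B v ->
  `|alpha (y, u) - alpha (z, v)| <=
    L * (d + nB)%:R * (`|y - z| + `|u - v|).
Proof.
move=> L0 [_ alphaL] Bu Bv; apply: le_trans (norm_le_enorm _) _.
apply: (le_trans (lip_const_le _ _ _ alphaL L0 _ _)) => //.
- exact: enorm2_gt0.
- exact: sqrtr_ge0.
- exact: enorm0.
by rewrite -mulrA ler_wpM2l//; exact: enorm2_le.
Qed.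

Lemma lipB_norm (M : R) b y z : 0 <= M -> lipB G M b ->
  `|b y - b z| <= M * d%:R * `|y - z|.
Proof.
move=> M0 [_ bM]; apply: le_trans (norm_le_enorm _) _.
apply: (le_trans (lip_const_le _ _ _ bM M0 _ _)) => //.
- exact: enorm_gt0.
- exact: enorm_ge0.
- exact: enorm0.
by rewrite -mulrA ler_wpM2l//; exact: enorm_le_norm.
Qed.

Lemma lip_const_cost (h : 'rV[R]_d -> R) :
  (lip_const (@enorm R d) (@Num.norm R R) [set: 'rV[R]_d] h < +oo)%E ->
  exists2 k : R, 0 <= k & forall x x', `|h x - h x'| <= k * `|x - x'|.
Proof.
move=> /lip_const_bound[k k0 hk]; exists (k * d%:R) => [|x x'].
  by rewrite mulr_ge0.
apply: (le_trans (lip_const_le (@enorm_gt0 _ _) _ _ hk k0 _ _)) => //.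
- exact: enorm_ge0.
- exact: normr0.
by rewrite -mulrA ler_wpM2l// enorm_le_norm.
Qed.

(** The growth bound is the Lipschitz bound against the fixed value [F G 0 a0 b0]; compactness
    bounds the distance of the controls to [a0] and [b0]. *)
Lemma F_lip_growth : 0 < horizon G -> A !=set0 -> compact A ->
  B !=set0 -> compact B ->
  (lip_const (@enorm3 R d nA nB) (@enorm R d)
     ([set: 'rV[R]_d] `*` A `*` B)
     (fun z => drift G z.1.1 z.1.2 z.2) < +oo)%E ->
  exists c kappa : R, [/\ 1 <= c, 0 <= kappa,
    forall x x' a a' b b', A a -> A a' -> B b -> B b' ->
      `|F G x a b - F G x' a' b'| <= c * (`|x - x'| + `|a - a'| + `|b - b'|) &
    forall x a b, A a -> B b -> `|F G x a b| <= c * `|x| + kappa].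
Proof.
move=> T0 [a0 Aa0] cA [b0 Bb0] cB /lip_const_bound[k k0 fk].
have tau0 : 0 <= tau G by rewrite divr_ge0// ltW.
have D0 : 0 <= (d + nA + nB)%:R :> R by exact: ler0n.
move: (d + nA + nB)%:R (@enorm3_le R d nA nB) D0 => D hD D0.
(* The summand 1 comes from the identity part of [F]; [D] converts Euclidean into maximum norms. *)
pose c := 1 + tau G * (k * D).
have c1 : 1 <= c by rewrite /c lerDl mulr_ge0// mulr_ge0.
have Flip x x' a a' b b' : A a -> A a' -> B b -> B b' ->
    `|F G x a b - F G x' a' b'| <= c * (`|x - x'| + `|a - a'| + `|b - b'|).
  move=> Aa Aa' Bb Bb'; rewrite /F opprD addrACA -scalerBr.
  apply: le_trans (ler_normD _ _) _; rewrite normrZ (ger0_norm tau0).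
  rewrite /c mulrDl mul1r lerD//.
    by rewrite -addrA lerDl addr_ge0.
  rewrite -mulrA ler_wpM2l//; apply: le_trans (norm_le_enorm _) _.
  apply: (le_trans (@lip_const_le _ _ _ _ _ _ _ _ (x, a, b) (x', a', b')
    (@enorm3_gt0 _ _ _ _) _ _ fk k0 _ _)) => //.
  - exact: sqrtr_ge0.
  - exact: enorm0.
  by rewrite -mulrA ler_wpM2l//; exact: hD.
have bnd n (S : set 'rV[R]_n) : compact S ->
    exists2 r, 0 <= r & forall x, S x -> `|x| <= r.
  move=> /compact_bounded[r [_ Sr]]; exists (`|r| + 1); first by rewrite addr_ge0.
  by move=> x; apply: Sr; rewrite (le_lt_trans (ler_norm r))// ltrDl.
have [rA rA0 hA] := bnd _ _ cA; have [rB rB0 hB] := bnd _ _ cB.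
exists c, (c * ((rA + rA) + (rB + rB)) + `|F G 0 a0 b0|); split => //.
  by rewrite addr_ge0// mulr_ge0 ?(le_trans ler01 c1)// !addr_ge0.
move=> x a b Aa Bb.
have := Flip x 0 _ _ _ _ Aa Aa0 Bb Bb0; rewrite subr0 => h1.
have := lerB_dist (F G x a b) (F G 0 a0 b0) => h2.
have ha : `|a - a0| <= rA + rA by rewrite (le_trans (ler_normB _ _))// lerD// hA.
have hb : `|b - b0| <= rB + rB by rewrite (le_trans (ler_normB _ _))// lerD// hB.
have : c * (`|x| + `|a - a0| + `|b - b0|) <= c * (`|x| + (rA + rA) + (rB + rB)).
  by rewrite ler_wpM2l ?(le_trans ler01 c1)// lerD// lerD2l.
lra.
Qed.

End game_bounds.

(** * Convergence of the scheme: upper and lower bounds in expectation *)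

Theorem theorem5p5 (R : realType) (d nA nB N : nat) (G : game R d nA nB N)
    (nA_gt0 : (0 < nA)%N) (nB_gt0 : (0 < nB)%N) (N_gt0 : (0 < N)%N)
    (T_gt0 : 0 < horizon G)
    (A_neq0 : ctrlA G !=set0) (A_compact : compact (ctrlA G))
    (B_neq0 : ctrlB G !=set0) (B_compact : compact (ctrlB G))
    (f_lip : (lip_const (@enorm3 R d nA nB) (@enorm R d)
                ([set: 'rV[R]_d] `*` ctrlA G `*` ctrlB G)
                (fun z => drift G z.1.1 z.1.2 z.2) < +oo)%E)
    (g_lip : (lip_const (@enorm R d) (@Num.norm R R) [set: 'rV[R]_d]
                (running G) < +oo)%E)
    (phi_lip : (lip_const (@enorm R d) (@Num.norm R R) [set: 'rV[R]_d]
                (terminal G) < +oo)%E)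
    (dd : measure_display) (Omega : measurableType dd)
    (P : probability Omega R) (X : Omega -> 'rV[R]_d)
    (X_meas : measurable_fun [set: Omega] (X : Omega -> borel R d))
    (X_supp : compact (rv_support P X))
    (X_int : ('E_P[fun w => enorm (X w)] < +oo)%E)
    (* parameters of the approximation spaces; Finf is "Theta -> oo" *)
    (Theta : Type) (Finf : set_system Theta) (FF : ProperFilter Finf)
    (Ghat : Theta -> set ('rV[R]_d * 'rV[R]_nB -> 'rV[R]_nA))
    (Bhat : Theta -> set ('rV[R]_d -> 'rV[R]_nB))
    (Ghat_sub : forall th, Ghat th `<=` measG G)
    (Bhat_sub : forall th, Bhat th `<=` measB G)
    (Ghat_dense : forall K : set 'rV[R]_d, compact K -> forall L : R, 0 < L ->
       forall alpha, lipG G L alpha ->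
       dist_Linf (@enorm R nA) (K `*` ctrlB G) alpha (Ghat th `&` lipG G L)
         @[th --> Finf] --> 0%E)
    (Bhat_dense : forall K : set 'rV[R]_d, compact K -> forall M : R, 0 < M ->
       forall b, lipB G M b ->
       dist_Linf (@enorm R nB) K b (Bhat th `&` lipB G M)
         @[th --> Finf] --> 0%E)
    (* every accuracy can be reached by some choice of L and M *)
    (accuracies : forall eta1 eta2 eps1 eps2 : R,
       0 < eta1 -> 0 < eta2 -> 0 < eps1 -> 0 < eps2 ->
       exists L M : R, [/\ 0 < L, 0 < M &
         accurate G P X Finf Ghat Bhat L M eta1 eta2 eps1 eps2]) :
  forall eps : R, 0 < eps ->
  exists2 delta : R, 0 < delta &
  forall eta1 eta2 eps1 eps2 : R,
    0 < eta1 <= delta -> 0 < eta2 <= delta ->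
    0 < eps1 <= delta -> 0 < eps2 <= delta ->
  exists L0 M0 : R, [/\ 0 < L0, 0 < M0,
    accurate G P X Finf Ghat Bhat L0 M0 eta1 eta2 eps1 eps2 &
    forall L M : R, L0 <= L -> M0 <= M ->
    \forall th \near Finf, forall ahat bhat,
      algorithm1 G P X (Ghat th) (Bhat th) L M eta1 eta2 ahat bhat ->
      accuracy2 G P X ahat M eps2 ->
      (`| \int[P]_w ((Jt0 G (X w) ahat bhat)%:E - V0 G (X w)) | <= eps%:E)%E].
Proof.
move=> eps eps0; have eps30 : 0 < eps / 3 by rewrite divr_gt0.
(* Each of the two bounds collects three errors of at most [eps / 3]: a margin, an accuracy and an
   approximation error. *)
exists (eps / 3) => // eta1 eta2 eps1 eps2.
move=> /andP[eta10 eta1e] /andP[eta20 eta2e] /andP[eps10 eps1e] /andP[eps20 eps2e].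
have [L0 [M0 [L00 M00 acc]]] := accuracies _ _ _ _ eta10 eta20 eps10 eps20.
exists L0, M0; split => // L M L0L M0M.
have L_ge0 : 0 <= L := le_trans (ltW L00) L0L.
have M_ge0 : 0 <= M := le_trans (ltW M00) M0M.
have [[alpha alphaL alphaV] _] := acc.
(* The strategy chosen for [L0] lies in the larger class of any [L >= L0]. *)
have {}alphaL k : lipG G L (alpha k).
  by have [aG aL] := alphaL k; split => //; exact: lip_const_mono aL.
have [c [kappa [c1 kappa0 F_lip F_growth]]] :=
  F_lip_growth T_gt0 A_neq0 A_compact B_neq0 B_compact f_lip.
have [Cg Cg0 Hg] := lip_const_cost g_lip.
have [Cphi Cphi0 Hphi] := lip_const_cost phi_lip.
pose C := Cg + Cphi.
have C0 : 0 <= C by rewrite addr_ge0.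
have HCg x x' : `|running G x - running G x'| <= C * `|x - x'|.
  by apply: (le_trans (Hg x x')); rewrite ler_wpM2r// lerDl.
have HCphi x x' : `|terminal G x - terminal G x'| <= C * `|x - x'|.
  by apply: (le_trans (Hphi x x')); rewrite ler_wpM2r// lerDr.
have c0 : 0 <= c := le_trans ler01 c1.
have [v vE vL] := V0_lip C0 c1 kappa0 F_lip F_growth HCg HCphi A_neq0 B_neq0.
pose La := L * (d + nB)%:R; pose Lb := M * d%:R.
have La0 : 0 <= La by rewrite mulr_ge0.
have Lb0 : 0 <= Lb by rewrite mulr_ge0.
have [r r0 PXr] := rv_support_bounded X_meas X_supp.
(* By the growth bound, [K] contains all trajectories that start in the ball of radius [r]. *)
pose K := [set x : 'rV[R]_d | `|x| <= c ^+ N * (r + N%:R * kappa)].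
have cK : compact K by exact: closed_ball_compact.
(* [E1] and [E2] are the coefficients of [delta] in [Jt0_le_net_value] and, with equal initial
   points, in [Jt0_perturb]. *)
pose E1 := N%:R * (C * (c * (1 + La)) ^+ N * (c * (La + 2))).
pose E2 := C * ((c * (1 + La * (1 + Lb) + Lb)) ^+ N * (N%:R * (c * (La + 1)))).
have E10 : 0 <= E1 by rewrite /E1 !mulr_ge0 ?exprn_ge0 ?mulr_ge0 ?addr_ge0.
have E20 : 0 <= E2.
  by rewrite /E2 !mulr_ge0 ?exprn_ge0 ?mulr_ge0 ?addr_ge0 ?mulr_ge0 ?addr_ge0.
pose delta := eps / 3 / (1 + E1 + E2).
have E120 : 0 < 1 + E1 + E2 by rewrite -addrA ltr_wpDr// addr_ge0.
have delta0 : 0 < delta by rewrite divr_gt0.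
have deltaE : (1 + E1 + E2) * delta = eps / 3 by rewrite mulrC divfK// gt_eqF.
have E1delta : E1 * delta <= eps / 3.
  by rewrite -deltaE ler_wpM2r ?(ltW delta0)//; lra.
have E2delta : E2 * delta <= eps / 3.
  by rewrite -deltaE ler_wpM2r ?(ltW delta0)//; lra.
have [y0 By0] := B_neq0.
have [s sB netB] := compact_net B_compact delta0.
have sB' y : y \in y0 :: s -> ctrlB G y by rewrite inE => /orP[/eqP ->|/sB].
have L_gt0 : 0 < L := lt_le_trans L00 L0L.
have M_gt0 : 0 < M := lt_le_trans M00 M0M.
have near1 : \forall th \near Finf, forall k, k \in enum 'I_N ->
    exists2 a', (Ghat th `&` lipG G L) a' &
      forall z, (K `*` ctrlB G) z -> `|alpha k z - a' z| <= delta.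
  apply: near_forall_seq => k _; apply: dist_Linf_near delta0.
  exact: Ghat_dense.
(* The feedback [bs] is known only after [th], hence one condition for all [M]-Lipschitz
   feedbacks. *)
have near2 : \forall th \near Finf, forall f, lipB G M f ->
    exists2 h, (Bhat th `&` lipB G M) h &
      forall x, K x -> `|f x - h x| <= delta.
  apply: (@uniform_approximation _ _ _ _ _ _ _ _ _ _ Lb _ cK B_compact) => //.
  - by move=> f x [[_ fB] _].
  - by move=> f x x'; exact: (@lipB_norm _ _ _ _ _ G).
  - by move=> f Lf; exact: Bhat_dense.
apply: filterS2 near1 near2 => th near1 near2 ahat bhat.
move=> [ahatG bhatB alg1 alg2] [bs bsL bsV].
have mEJt a b : EJt G P X a b = (\int[P]_w (Jt0 G (X w) a b)%:E)%E.
  by rewrite /EJt unlock.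
have iv := lipschitz_integrable X_meas X_int vL.
have EV0E : EV0 G P X = (\int[P]_w (v (X w))%:E)%E.
  by apply: eq_integral => w _; rewrite vE.
have lip_ahat (b : 'I_N -> _) : (forall k, lipB G M (b k)) ->
    forall x x', `|Jt0 G x ahat b - Jt0 G x' ahat b| <=
      C * (c * (1 + La * (1 + Lb) + Lb)) ^+ N * `|x - x'|.
  move=> bL x x'; apply: (Jt0_lip C0 c1 F_lip HCg HCphi) => //.
  - by move=> k; have [_ []] := ahatG k.
  - by move=> k y; have [[_ +] _] := bL k; apply.
  - by move=> k y z u w Bu Bw; apply: (@lipG_norm _ _ _ _ _ G) => //; have [] := ahatG k.
  - by move=> k y z; apply: (@lipB_norm _ _ _ _ _ G).
have bhatL k : lipB G M (bhat k) by have [] := bhatB k.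
have iu := lipschitz_integrable X_meas X_int (lip_ahat _ bhatL).
have trajK x (a : 'I_N -> _) (b : 'I_N -> _) : (forall k, measG G (a k)) ->
    (forall k y, ctrlB G (b k y)) -> `|x| <= r -> forall k, (k < N)%N ->
    K (traj (fun k y => F G y (a k (y, b k y)) (b k y)) x k).
  move=> aG Bb xr k kN; rewrite /K /=.
  have := controlled_bounded c1 kappa0 F_growth (feedback_controlled x aG Bb) (ltnW kN).
  move=> /le_trans; apply; rewrite ler_wpM2l ?exprn_ge0//.
  by rewrite lerD2r.
have mr := measurable_norm_le X_meas r.
(* Chain: the payoff of the output is at most the supremum over [Bhat th] against [ahat], then
   against [alpha'] up to [eta1], then the expectation of [W] up to [eps / 3], then the supremum
   over all measurable feedbacks against [alpha], then the value up to [eps1]. *)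
have upper : (EJt G P X ahat bhat <= EV0 G P X + eps%:E)%E.
  have ex k : exists a', (Ghat th `&` lipG G L) a' /\
      forall z, (K `*` ctrlB G) z -> `|alpha k z - a' z| <= delta.
    by have [|a' h1 h2] := near1 k; [rewrite mem_enum|exists a'].
  have [alpha' Halpha'] := choice ex.
  have alphaG k : measG G (alpha k) by have [] := alphaL k.
  have alpha'G k : measG G (alpha' k) by have [[_ []]] := Halpha' k.
  have alpha_lip k y z u w : ctrlB G u -> ctrlB G w ->
      `|alpha k (y, u) - alpha k (z, w)| <= La * (`|y - z| + `|u - w|).
    by move=> Bu Bw; exact: (@lipG_norm _ _ _ _ _ G).
  pose W := net_value G alpha y0 s N.
  have WL x x' : `|W x - W x'| <= C * (c * (1 + La)) ^+ N * `|x - x'|.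
    exact: (net_value_lip C0 c1 La0 F_lip HCg HCphi alphaG alpha_lip sB').
  have iW := lipschitz_integrable X_meas X_int WL.
  have step1 : (supEJt G P X (Bhat th) alpha' <=
      \int[P]_w (W (X w))%:E + (eps / 3)%:E)%E.
    rewrite /supEJt; apply: ge_ereal_sup => _ [b bB <-].
    rewrite -expectation_addr// mEJt.
    have Bb k y : ctrlB G (b k y) by have [_] := Bhat_sub _ _ (bB k); apply.
    apply: (le_integral_ae mr PXr).
      apply/measurable_EFinP; apply: measurable_funD => //.
      exact: lipschitz_comp_measurable WL.
    move=> w wr; rewrite lee_fin.
    have := @Jt0_le_net_value _ _ _ _ _ G C c La C0 c1 La0 F_lip HCg HCphi
      alpha alphaG alpha_lip y0 s sB' (X w) alpha' b K delta (ltW delta0)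
      alpha'G Bb _ _ (trajK _ _ _ alpha'G Bb wr).
    move=> H; apply: le_trans (H _ _) _.
    - by move=> u /netB[y ys uy]; exists y => //; rewrite inE ys orbT.
    - by move=> k z u Kz Bu; have [_] := Halpha' k; apply; split.
    by rewrite lerD2l -/W; apply: le_trans E1delta; rewrite /E1 !mulrA.
  (* The greedy feedback is measurable, so it competes in the supremum over [measB]. *)
  have step2 : (\int[P]_w (W (X w))%:E <= supEJt G P X (measB G) alpha)%E.
    apply: (@le_trans _ _ (EJt G P X alpha (net_feedback G alpha y0 s))).
      rewrite mEJt; apply: le_integral_pointwise => w; rewrite lee_fin.
      exact: net_value_le_Jt0.
    apply: ereal_sup_ubound; exists (net_feedback G alpha y0 s) => // k.
    exact: (net_feedback_meas C0 c1 La0 F_lip HCg HCphi alphaG alpha_lip sB').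
  have step3 : (EJt G P X ahat bhat <= supEJt G P X (Bhat th) alpha' + eta1%:E)%E.
    apply: (@le_trans _ _ (supEJt G P X (Bhat th) ahat)).
      by apply: ereal_sup_ubound; exists bhat => // k; have [] := bhatB k.
    apply: (le_trans alg1); rewrite leeD2r//; apply: ereal_inf_lbound.
    by exists alpha' => // k; have [[]] := Halpha' k.
  apply: (le_trans step3); apply: (le_trans (leeD2r _ step1)).
  move: alphaV; rewrite leeBlDr// => /(le_trans step2) step4.
  have := leeD2r eta1%:E (leeD2r (eps / 3)%:E step4) => /le_trans; apply.
  move: (EV0 G P X) => Z.
  by rewrite -!addeA leeD2l// -!EFinD lee_fin; lra.
(* Chain: the value is at most the payoff of [bs] against [ahat] up to [eps2], then that of its
   approximation [b'] up to [eps / 3], then that of [bhat] up to [eta2]. *)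
have lower : (EV0 G P X <= EJt G P X ahat bhat + eps%:E)%E.
  have ex k : exists b', (Bhat th `&` lipB G M) b' /\
      forall x, K x -> `|bs k x - b' x| <= delta.
    by have [b' h1 h2] := near2 _ (bsL k); exists b'.
  have [b' Hb'] := choice ex.
  have b'L k : lipB G M (b' k) by have [[]] := Hb' k.
  have ib' := lipschitz_integrable X_meas X_int (lip_ahat _ b'L).
  have ahatM k : measG G (ahat k) by have [_ []] := ahatG k.
  have Bbs k y : ctrlB G (bs k y) by have [[_ +] _] := bsL k; apply.
  have Bb' k y : ctrlB G (b' k y) by have [[_ +] _] := b'L k; apply.
  have step1 : (EJt G P X ahat bs <= EJt G P X ahat b' + (eps / 3)%:E)%E.
    rewrite !mEJt -expectation_addr//; apply: (le_integral_ae mr PXr).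
      apply/measurable_EFinP; apply: measurable_funD => //.
      exact: lipschitz_comp_measurable (lip_ahat _ b'L).
    move=> w wr; rewrite lee_fin.
    have := @Jt0_perturb _ _ _ _ _ G C c C0 c1 F_lip HCg HCphi La Lb delta K
      (X w) (X w) ahat bs b' La0 Lb0 (ltW delta0) ahatM Bbs Bb' _ _
      (trajK _ _ _ ahatM Bbs wr).
    move=> H; apply: le_trans (H _ _) _.
    - by move=> k y z u t Bu Bt; apply: (@lipG_norm _ _ _ _ _ G) => //; have [] := ahatG k.
    (* Through [b' k y]: closeness on [K] gives [delta], and [b'] is itself [M]-Lipschitz. *)
    - move=> k y z Ky; apply: le_trans (ler_distD (b' k y) _ _) _.
      rewrite addrC lerD//; first exact: (@lipB_norm _ _ _ _ _ G).
      by have [_] := Hb' k; apply.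
    rewrite lerD2l subrr normr0 add0r; apply: le_trans E2delta.
    by rewrite /E2 !mulrA.
  have step2 : (EJt G P X ahat b' <= EJt G P X ahat bhat + eta2%:E)%E.
    rewrite -leeBlDr//; apply: le_trans alg2; rewrite leeD2r//.
    by apply: ereal_sup_ubound; exists b' => // k; have [[]] := Hb' k.
  apply: (le_trans bsV); apply: (le_trans (leeD2r _ step1)).
  have := leeD2r eps2%:E (leeD2r (eps / 3)%:E step2) => /le_trans; apply.
  move: (EJt G P X ahat bhat) => Z.
  by rewrite -!addeA leeD2l// -!EFinD lee_fin; lra.
(* Both terms are integrable, so the expectation splits and the two bounds become inequalities
   between real numbers. *)
have -> : (\int[P]_w ((Jt0 G (X w) ahat bhat)%:E - V0 G (X w)) =
    EJt G P X ahat bhat - EV0 G P X)%E.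
  rewrite mEJt EV0E -integralB_EFin//.
  by apply: eq_integral => w _; rewrite vE.
move: upper lower; rewrite mEJt EV0E.
rewrite -(fineK (integrable_fin_num measurableT iu)).
rewrite -(fineK (integrable_fin_num measurableT iv)).
move: (fine _) (fine _) => p q; rewrite -!EFinD !lee_fin => h1 h2.
by rewrite ler_norml; apply/andP; split; lra.
Qed.
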